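(* Consider a two-player zero-sum stochastic game with state space $S_o=S\cup\{0\}$, $S=\{1,\dots,n\}$, as described in the context, and suppose the Continuity Condition, the Minimax Regularity Condition and the SSP Game Model Assumption hold. Then the game has a finite value function $x^*\in\mathbb{R}^n$, i.e. $\bar x^*_i=\underline x^*_i=x^*_i\in\mathbb{R}$ for all $i\in S$, and $x^*$ is the unique solution of the equation $x=Tx$. Furthermore, there exist $\mu^*\in\Pi_1^{SD}$, $\nu^*\in\Pi_2^{SD}$ with $x^*=T_{\mu^*}x^*=\tilde T_{\nu^*}x^*$; any such $\mu^*,\nu^*$ are essentially proper (hence the pair $(\mu^*,\nu^* )$ is non-prolonging), and $(\mu^*,\nu^* )$ is a pair of equilibrium policies, with $\mu^*$ optimal for player I and $\nu^*$ optimal for player II.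
   Context: Game model. $S=\{1,\dots,n\}$, $S_o=S\cup\{0\}$, where $0$ is an absorbing, cost-free termination state. At state $i\in S$, player I chooses a control $\bar u$ from a compact set $\bar U(i)$ and player II a control $\bar v$ from a compact set $\bar V(i)$ (compact subsets of complete separable metric spaces). Under $(\bar u,\bar v)$ an expected one-stage cost $c_i(\bar u,\bar v)\in\mathbb{R}$ (possibly negative) is paid by player I to player II and the state moves to $j\in S_o$ with probability $p_{ij}(\bar u,\bar v)$. Players may use the full history (past states and both players' past controls). $\Pi_1,\Pi_2$ denote the sets of history-dependent randomized policies of players I and II. For $(\pi_1,\pi_2)\in\Pi_1\times\Pi_2$ and $i\in S$, $x_i(\pi_1,\pi_2)=\liminf_{t\to\infty}E_{\pi_1\pi_2}[\sum_{k=0}^t c_{i_k}(\bar u_k,\bar v_k)\mid i_0=i]$. Upper value $\bar x^*_i=\inf_{\pi_1}\sup_{\pi_2}x_i(\pi_1,\pi_2)$, lower value $\underline x^*_i=\sup_{\pi_2}\inf_{\pi_1}x_i(\pi_1,\pi_2)$; if they coincide for all $i$ the common vector is the value function. An optimal policy for player I (II) attains the outer infimum (supremum) in $\bar x^*_i$ ($\underline x^*_i$) for all $i$. $(\pi_1^*,\pi_2^* )$ is a pair of equilibrium policies if $x(\pi_1^*,\pi_2)\le x(\pi_1^*,\pi_2^* )\le x(\pi_1,\pi_2^* )$ for all $\pi_1\in\Pi_1,\pi_2\in\Pi_2$. Stationary deterministic policies: $\Pi_1^{SD}=\{\mu: \mu(i)\in\bar U(i),\ i\in S\}$, $\Pi_2^{SD}=\{\nu:\nu(i)\in\bar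 V(i),\ i\in S\}$. For $(\mu,\nu)$ let $c(\mu,\nu)\in\mathbb{R}^n$ have components $c_i(\mu(i),\nu(i))$ and $P(\mu,\nu)$ be the $n\times n$ substochastic matrix with entries $p_{ij}(\mu(i),\nu(i))$, $i,j\in S$. Operators on $\mathbb{R}^n$ (optimizations componentwise): $T_{\mu\nu}x=c(\mu,\nu)+P(\mu,\nu)x$; $T_\mu x=\sup_{\nu\in\Pi_2^{SD}}T_{\mu\nu}x$; $\tilde T_\nu x=\inf_{\mu\in\Pi_1^{SD}}T_{\mu\nu}x$; $Tx=\inf_{\mu}\sup_{\nu}T_{\mu\nu}x$; $\tilde Tx=\sup_\nu\inf_\mu T_{\mu\nu}x$. Continuity Condition: for all $i,j\in S$, $p_{ij}(\bar u,\bar v)$ is continuous on $\bar U(i)\times\bar V(i)$, and $c_i(\bar u,\bar v)$ is lower semicontinuous in $\bar u$ for fixed $\bar v$ and upper semicontinuous in $\bar v$ for fixed $\bar u$. Minimax Regularity Condition: $Tx=\tilde Tx$ for all $x\in\mathbb{R}^n$. A pair of policies is prolonging if under it, for some initial state, the termination state is never reached with positive probability; otherwise (termination reached w.p.1 from every initial state) it is non-prolonging. SSP Game Model Assumption: (i) there is $\bar\mu\in\Pi_1^{SD}$ with $x_i(\bar\mu,\nu)<+\infty$ for all $\nu\in\Pi_2^{SD}$ and all $i$; (ii) there is $\bar\nu\in\Pi_2^{SD}$ with $x_i(\mu,\bar\nu)>-\infty$ for all $\mu\in\Pi_1^{SD}$ and all $i$; (iii) for every prolonging pair $(\mu,\nu)\in\Pi_1^{SD}\times\Pi_2^{SD}$,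 $x_i(\mu,\nu)\in\{+\infty,-\infty\}$ for at least one $i$. Essentially proper: $\mu\in\Pi_1^{SD}$ is essentially proper if there is $\nu\in\Pi_2^{SD}$ with $(\mu,\nu)$ non-prolonging and, for every $\nu\in\Pi_2^{SD}$ with $(\mu,\nu)$ prolonging, $x_i(\mu,\nu)=-\infty$ for some $i$. $\nu\in\Pi_2^{SD}$ is essentially proper if there is $\mu\in\Pi_1^{SD}$ with $(\mu,\nu)$ non-prolonging and, for every $\mu$ with $(\mu,\nu)$ prolonging, $x_i(\mu,\nu)=+\infty$ for some $i$. *)

(* Defs.v *)
From HB Require Import structures.
From mathcomp Require Import all_boot all_order all_algebra.
From mathcomp Require Import all_classical all_reals all_analysis.
From mathcomp Require Import measurable_realfun.

Set Implicit Arguments.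
Unset Strict Implicit.
Unset Printing Implicit Defensive.

Import Order.TTheory GRing.Theory Num.Theory.
Import numFieldNormedType.Exports.

Local Open Scope classical_set_scope.
Local Open Scope ring_scope.

Definition separable_space {T : topologicalType} :=
  exists D : set T, countable D /\ closure D = setT.

Notation Borel T := (g_sigma_algebraType (@open T)).

(* The data of the game.  States S = 'I_n (state i : 'I_n is state i+1 of the
   paper); the termination state 0 is implicit: p_{i0} = 1 - \sum_j p_{ij}.
   Controls of player I live in U, of player II in V; Ubar i, Vbar i are the
   admissible control sets at state i.  cst i u v = c_i(u,v),
   prb i j u v = p_{ij}(u,v) for i, j in S. *)
Record game (R : realType) (n : nat)
    (U V : completePseudoMetricType R) := Game {
  Ubar : 'I_n -> set U;
  Vbar : 'I_n -> set V;
  cst : 'I_n -> U -> V -> R;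
  prb : 'I_n -> 'I_n -> U -> V -> R }.

Section game_defs.
Context (R : realType) (n : nat) (U V : completePseudoMetricType R).
Variable G : @game R n U V.

Local Notation Ub := (Ubar G).
Local Notation Vb := (Vbar G).
Local Notation c := (cst G).
Local Notation p := (prb G).

Definition game_model :=
  (forall i, compact (Ub i)) /\ (forall i, compact (Vb i)) /\
  (forall i u v, Ub i u -> Vb i v ->
     (forall j, 0 <= p i j u v) /\ \sum_(j < n) p i j u v <= 1).

(* Controls part of a history of length k: ((..(tt,(u0,v0)),..),(u_{k-1},v_{k-1})),
   with the product Borel sigma-algebra. *)
Fixpoint CT (k : nat) : {d : measure_display & measurableType d} :=
  match k with
  | 0 => existT measurableType _ (unit : measurableType _)
  | k'.+1 => existT measurableType _
       (((projT2 (CT k')) * (Borel U * Borel V))%type : measurableType _)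
  end.

Local Notation hist k := (projT2 (CT k)).

(* A history at time k (before termination) is a state sequence
   s = (i_0,...,i_k) in S^(k+1) together with the past controls h : hist k.
   (Once the termination state is reached nothing more happens, so decisions are
   only needed on histories whose states all lie in S.)  A decision rule
   returns a set function on the control space, required below to be a
   probability measure concentrated on the admissible set and measurable in h. *)
Definition rule1 := forall k : nat, k.+1.-tuple 'I_n -> hist k -> set (Borel U) -> \bar R.
Definition rule2 := forall k : nat, k.+1.-tuple 'I_n -> hist k -> set (Borel V) -> \bar R.

Definition is_prob {d} {T : measurableType d} (m : set T -> \bar R) :=
  exists P : probability T R, forall A, P A = m A.

Definition cur k (s : k.+1.-tuple 'I_n) : 'I_n := tnth s ord_max.

Definition policy1 (pi : rule1) :=
  forall k (s : k.+1.-tuple 'I_n),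
    (forall h, is_prob (pi k s h) /\ pi k s h (~` Ub (cur s)) = 0%E) /\
    (forall A : set (Borel U), measurable A -> measurable_fun setT (fun h => pi k s h A)).

Definition policy2 (pi : rule2) :=
  forall k (s : k.+1.-tuple 'I_n),
    (forall h, is_prob (pi k s h) /\ pi k s h (~` Vb (cur s)) = 0%E) /\
    (forall A : set (Borel V), measurable A -> measurable_fun setT (fun h => pi k s h A)).

Definition Pi1 : set rule1 := [set pi | policy1 pi].
Definition Pi2 : set rule2 := [set pi | policy2 pi].

(* Vexp p1 p2 m k s h = expected cost of the next m stages (k,...,k+m-1)
   given the history (s,h) at time k: the controls are drawn independently
   (product measure) from p1 k s h and p2 k s h, the cost c_i(u,v) is paid,
   and the state moves to j in S w.p. p_{ij}(u,v) (to the cost-free absorbing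
   state 0 with the remaining probability). *)
Fixpoint Vexp (p1 : rule1) (p2 : rule2) (m k : nat) (s : k.+1.-tuple 'I_n)
    (h : hist k) {struct m} : \bar R :=
  match m with
  | 0 => 0%E
  | m'.+1 =>
      (\int[(p1 k s h \x p2 k s h)%E]_uv
         ((c (cur s) uv.1 uv.2)%:E +
          \sum_(j < n) (p (cur s) j uv.1 uv.2)%:E *
             Vexp p1 p2 m' [tuple of rcons s j] ((h, uv) : hist k.+1)))%E
  end.

Definition xc (p1 : rule1) (p2 : rule2) (i : 'I_n) : \bar R :=
  limn_einf (fun t => Vexp p1 p2 t.+1 [tuple i] (tt : hist 0)).

Definition upper_value (i : 'I_n) : \bar R :=
  ereal_inf [set ereal_sup [set xc p1 p2 i | p2 in Pi2] | p1 in Pi1].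
Definition lower_value (i : 'I_n) : \bar R :=
  ereal_sup [set ereal_inf [set xc p1 p2 i | p1 in Pi1] | p2 in Pi2].

Definition optimal1 (p1 : rule1) :=
  Pi1 p1 /\ forall i, ereal_sup [set xc p1 p2 i | p2 in Pi2] = upper_value i.
Definition optimal2 (p2 : rule2) :=
  Pi2 p2 /\ forall i, ereal_inf [set xc p1 p2 i | p1 in Pi1] = lower_value i.

Definition equilibrium (p1 : rule1) (p2 : rule2) :=
  forall q1 q2, Pi1 q1 -> Pi2 q2 ->
    forall i, (xc p1 q2 i <= xc p1 p2 i)%E /\ (xc p1 p2 i <= xc q1 p2 i)%E.

Definition SD1 : set ('I_n -> U) := [set mu | forall i, Ub i (mu i)].
Definition SD2 : set ('I_n -> V) := [set nu | forall i, Vb i (nu i)].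

Definition stat1 (mu : 'I_n -> U) : rule1 :=
  fun k s h => @dirac _ (Borel U) (mu (cur s)) R.
Definition stat2 (nu : 'I_n -> V) : rule2 :=
  fun k s h => @dirac _ (Borel V) (nu (cur s)) R.

Definition xSD (mu : 'I_n -> U) (nu : 'I_n -> V) := xc (stat1 mu) (stat2 nu).

(* alive mu nu t i = P(i_t in S | i_0 = i) = (P(mu,nu)^t 1)_i *)
Fixpoint alive (mu : 'I_n -> U) (nu : 'I_n -> V) (t : nat) (i : 'I_n) : R :=
  match t with
  | 0 => 1
  | t'.+1 => \sum_(j < n) p i j (mu i) (nu i) * alive mu nu t' j
  end.

Definition nonprolonging mu nu :=
  forall i, alive mu nu t i @[t --> \oo] --> (0 : R).
Definition prolonging mu nu := ~ nonprolonging mu nu.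

Definition Tmn (mu : 'I_n -> U) (nu : 'I_n -> V) (x : 'I_n -> R) (i : 'I_n) : R :=
  c i (mu i) (nu i) + \sum_(j < n) p i j (mu i) (nu i) * x j.
Definition Tmu mu x i : \bar R := ereal_sup [set (Tmn mu nu x i)%:E | nu in SD2].
Definition Tnu nu x i : \bar R := ereal_inf [set (Tmn mu nu x i)%:E | mu in SD1].
Definition Top x i : \bar R := ereal_inf [set Tmu mu x i | mu in SD1].
Definition Ttil x i : \bar R := ereal_sup [set Tnu nu x i | nu in SD2].

Definition continuity_condition :=
  forall i,
    (forall j, {within Ub i `*` Vb i, continuous (fun uv : U * V => p i j uv.1 uv.2)}) /\
    (forall v, Vb i v ->
       @lower_semicontinuous (subspace (Ub i)) R (fun u => (c i u v)%:E)) /\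
    (forall u, Ub i u ->
       @lower_semicontinuous (subspace (Vb i)) R (fun v => (- (c i u v)%:E)%E)).

Definition minimax_regularity := forall x i, Top x i = Ttil x i.

Definition SSP_assumption :=
  (exists2 mub, SD1 mub & forall nu, SD2 nu -> forall i, (xSD mub nu i < +oo)%E) /\
  (exists2 nub, SD2 nub & forall mu, SD1 mu -> forall i, (xSD mu nub i > -oo)%E) /\
  (forall mu nu, SD1 mu -> SD2 nu -> prolonging mu nu ->
     exists i, xSD mu nu i = +oo%E \/ xSD mu nu i = -oo%E).

Definition essentially_proper1 (mu : 'I_n -> U) :=
  (exists2 nu, SD2 nu & nonprolonging mu nu) /\
  (forall nu, SD2 nu -> prolonging mu nu -> exists i, xSD mu nu i = -oo%E).
Definition essentially_proper2 (nu : 'I_n -> V) :=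
  (exists2 mu, SD1 mu & nonprolonging mu nu) /\
  (forall mu, SD1 mu -> prolonging mu nu -> exists i, xSD mu nu i = +oo%E).

End game_defs.

(* Main.v *)
Require Import Defs.
From HB Require Import structures.
From mathcomp Require Import all_boot all_order all_algebra.
From mathcomp Require Import all_classical all_reals all_analysis.
From mathcomp Require Import measurable_realfun lra.
Import Order.TTheory GRing.Theory Num.Theory.
Import numFieldNormedType.Exports.
Local Open Scope classical_set_scope.
Local Open Scope ring_scope.

Set Implicit Arguments.
Unset Strict Implicit.
Unset Printing Implicit Defensive.

(* If mu solves T_mu x = x, every policy of player II costs at most
   lim_t T_mu^t (x + L) = x, and symmetrically for player II, so the theorem
   reduces to dynamic programming on R^n.

   Inserting a subsolution y <= T_{mu,nu} y bounds the partial sums of the costs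
   below, a supersolution bounds them above; with both, assumption (iii) makes
   (mu, nu) non-prolonging, and then y <= x for every such pair y, x.  This gives
   uniqueness and the properties of mu*, nu*.

   Existence is a monotone fixed point argument, which needs the subsolutions of
   T_{mub}, for mub as in assumption (i), to be bounded.  Otherwise take
   subsolutions x_k with maximum tending to infinity and subtract the maximum: on
   the states that stay within bounded distance of it, the limit is a subsolution
   for a limit policy that never leaves these states.  Glued with a
   non-prolonging policy elsewhere, this is a prolonging policy with a
   subsolution, which is impossible.  Exchanging the players bounds the
   supersolutions of T~_{nub}, so the infimum of the supersolutions of T is a
   fixed point. *)

(** * Integral bounds without measurability *)

(* The costs are only separately semicontinuous, so the integrands of Vexp need
   not be jointly measurable; none of the bounds below asks for measurability. *)
Section integral_bounds.
Local Open Scope ereal_scope.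
Context d (T : measurableType d) (R : realType).
Import HBNNSimple.

(** The integral of a nonnegative function is a supremum over the simple functions below it, which
    is monotone for arbitrary integrands. *)
Lemma ge0_le_integral_nonmeasurable (P : {measure set T -> \bar R}) (f g : T -> \bar R) :
  (forall x, 0 <= f x) -> (forall x, f x <= g x) ->
  \int[P]_x f x <= \int[P]_x g x.
Proof.
move=> f0 fg; have g0 x : 0 <= g x by exact: le_trans (fg x).
rewrite !ge0_integralTE//; apply: ereal_sup_le => _ [h /= hf <-].
by exists h => // x; exact: le_trans (fg x).
Qed.

Context (P : probability T R) (D : set T) (mD : measurable D) (PD : P D = 1).

(** [f] lies below the measurable function equal to K on D and to +oo elsewhere, whose integral is
    at most K because the complement of D is null. *)
Lemma ge0_integral_le_on (f : T -> \bar R) (K : R) :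
  (forall x, 0 <= f x) -> (forall x, D x -> f x <= K%:E) ->
  \int[P]_x f x <= K%:E.
Proof.
move=> f0 fK.
have K0 : 0 <= K%:E.
  have : D !=set0.
    apply/set0P/eqP => D0; move: PD; rewrite D0 measure0 => /eqP.
    by rewrite eq_sym onee_eq0.
  by move=> [x Dx]; exact: le_trans (f0 x) (fK x Dx).
have PDC : P (~` D) = 0 by rewrite probability_setC// PD subee.
pose g x := if x \in D then K%:E else +oo.
have mg : measurable_fun setT g.
  apply: measurable_fun_ifT => //=; apply: (measurable_fun_bool true).
  rewrite setTI (_ : _ @^-1` _ = D)//; apply/seteqP; split => x /=.
    by move/set_mem.
  by move=> Dx; exact: mem_set.
apply: (@le_trans _ _ (\int[P]_x g x)).
  apply: ge0_le_integral_nonmeasurable => // x; rewrite /g.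
  by case: ifPn => [/set_mem/fK//|_]; rewrite leey.
rewrite (@ge0_ae_eq_integral _ _ _ P setT g (cst K%:E)) //.
- by rewrite integral_cst//= -[X in _ <= X]mule1 lee_wpmul2l// probability_le1.
- by move=> x _; rewrite /g; case: ifP => // _; rewrite leey.
- exists (~` D); split => //; first exact: measurableC.
  move=> x /= /existsNP [_ gx] Dx; apply: gx; rewrite /g mem_set//.
Qed.

Lemma ge0_integral_ge_on (f : T -> \bar R) (K : R) : (0 <= K)%R ->
  (forall x, 0 <= f x) -> (forall x, D x -> K%:E <= f x) ->
  K%:E <= \int[P]_x f x.
Proof.
move=> K0 f0 fK.
apply: (@le_trans _ _ (\int[P]_x (K * \1_D x)%:E)).
  under eq_integral do rewrite EFinM.
  rewrite ge0_integralZl ?lee_fin//.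
  - by rewrite integral_indic// setIT /= PD mule1.
  - by apply/measurable_EFinP; exact: measurable_indic.
apply: ge0_le_integral_nonmeasurable => x.
  by rewrite lee_fin mulr_ge0.
rewrite indicE; case: (boolP (x \in D)) => [/set_mem Dx|_] /=.
  by rewrite mulr1 fK.
by rewrite mulr0.
Qed.

(** For K >= 0 the positive part integrates to at most K; for K < 0 it integrates to 0 and the
    negative part to at least -K. The first integral is thus finite, and no difference oo - oo
    arises. *)
Lemma integral_le_on (f : T -> \bar R) (K : R) :
  (forall x, D x -> f x <= K%:E) -> \int[P]_x f x <= K%:E.
Proof.
move=> fK; rewrite integralE.
have [K0|K0] := leP 0%R K.
  apply: (@le_trans _ _ (\int[P]_x f ^\+ x)).
    by rewrite geeDl// oppe_le0 integral_ge0.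
  by apply: ge0_integral_le_on => // x Dx; rewrite funeposE ge_max fK//= lee_fin.
have -> : \int[P]_x f ^\+ x = 0.
  apply/eqP; rewrite eq_le integral_ge0// andbT.
  apply: ge0_integral_le_on => // x Dx; rewrite funeposE ge_max lexx andbT.
  by apply: le_trans (fK _ Dx) _; rewrite lee_fin ltW.
rewrite add0e leeNl -EFinN; apply: ge0_integral_ge_on => //.
  by rewrite lerNr oppr0 ltW.
by move=> x Dx; rewrite funenegE le_max EFinN leeN2 fK.
Qed.

Lemma integral_ge_on (f : T -> \bar R) (K : R) :
  (forall x, D x -> K%:E <= f x) -> K%:E <= \int[P]_x f x.
Proof.
move=> fK; rewrite integralE.
have [K0|K0] := leP 0%R K.
  have -> : \int[P]_x f ^\- x = 0.
    apply/eqP; rewrite eq_le integral_ge0// andbT.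
    apply: ge0_integral_le_on => // x Dx; rewrite funenegE ge_max lexx andbT.
    by rewrite leeNl oppe0; apply: le_trans (fK _ Dx); rewrite lee_fin.
  rewrite sube0; apply: ge0_integral_ge_on => // x Dx.
  by rewrite funeposE le_max fK.
apply: (@le_trans _ _ (- \int[P]_x f ^\- x)); last first.
  by rewrite leeDr// integral_ge0.
rewrite leeNr -EFinN; apply: ge0_integral_le_on => // x Dx.
by rewrite funenegE ge_max EFinN leeN2 fK//= lee_fin lerNr oppr0 ltW.
Qed.

End integral_bounds.

Section product_integral_bounds.
Local Open Scope ereal_scope.
Context d1 d2 (T1 : measurableType d1) (T2 : measurableType d2) (R : realType).
Variables (m1 : set T1 -> \bar R) (m2 : set T2 -> \bar R).
Variables (A : set T1) (B : set T2) (mA : measurable A) (mB : measurable B).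
Hypotheses (P1 : is_prob m1) (P2 : is_prob m2).
Hypotheses (m1A : m1 (~` A) = 0) (m2B : m2 (~` B) = 0).

(** Agreement with a bundled probability on all sets lets it replace the bare set function; a
    rectangle with sides of full measure then has full product measure. *)
Let product_probability_on : exists P : probability (T1 * T2)%type R,
  (P : set (T1 * T2) -> \bar R) = (m1 \x m2) /\ P (A `*` B) = 1.
Proof.
case: P1 => Q1 /funext E1; case: P2 => Q2 /funext E2.
have Q1A : Q1 A = 1.
  by rewrite -(setCK A) probability_setC ?E1 ?m1A ?sube0//; exact: measurableC.
have Q2B : Q2 B = 1.
  by rewrite -(setCK B) probability_setC ?E2 ?m2B ?sube0//; exact: measurableC.
exists ((Q1 \x Q2) : probability _ _); split.
  by rewrite -E1 -E2.
by rewrite /= product_measure1E//= Q1A Q2B mule1.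
Qed.

Lemma product_integral_le_on (f : T1 * T2 -> \bar R) (K : R) :
  (forall x y, A x -> B y -> f (x, y) <= K%:E) ->
  \int[m1 \x m2]_z f z <= K%:E.
Proof.
move=> fK; have [P [<- PAB]] := product_probability_on.
apply: (integral_le_on (D := A `*` B)) => //; first exact: measurableX.
by move=> [x y] [] /=; exact: fK.
Qed.

Lemma product_integral_ge_on (f : T1 * T2 -> \bar R) (K : R) :
  (forall x y, A x -> B y -> K%:E <= f (x, y)) ->
  K%:E <= \int[m1 \x m2]_z f z.
Proof.
move=> fK; have [P [<- PAB]] := product_probability_on.
apply: (integral_ge_on (D := A `*` B)) => //; first exact: measurableX.
by move=> [x y] [] /=; exact: fK.
Qed.

End product_integral_bounds.

(** * Expected costs under arbitrary policies *)

Lemma limn_einf_le (R : realType) (u v : (\bar R)^nat) :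
  (forall t, u t <= v t)%E -> (limn_einf u <= limn_einf v)%E.
Proof.
move=> uv; rewrite !limn_einf_lim.
apply: lee_lim; [exact: is_cvg_einfs|exact: is_cvg_einfs|apply: nearW => m].
apply: le_ereal_inf_tmp => _ /= [k mk <-].
by apply: le_trans (uv k); apply: ereal_inf_lbound; exists k.
Qed.

(** The shift matches [xc], whose t-th term sums the costs of t+1 stages. *)
Lemma limn_einf_EFin (R : realType) (z : R^nat) (x : R) :
  z t @[t --> \oo] --> x -> limn_einf (fun t => (z t.+1)%:E) = x%:E.
Proof.
move=> zx; apply: (cvg_limn_einf_sup _).1.
by apply: cvg_EFin; [exact: nearW|rewrite cvg_shiftS].
Qed.

Section expected_cost_bounds.
Context (R : realType) (n : nat) (U V : completePseudoMetricType R).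
Variable G : @game R n U V.
Variables (A : 'I_n -> set U) (B : 'I_n -> set V).
Hypothesis mA : forall i, measurable (A i : set (Borel U)).
Hypothesis mB : forall i, measurable (B i : set (Borel V)).
Variables (q1 : @rule1 R n U V) (q2 : @rule2 R n U V).
Hypothesis q1A : forall k s h, is_prob (@q1 k s h) /\ @q1 k s h (~` A (cur s)) = 0%E.
Hypothesis q2B : forall k s h, is_prob (@q2 k s h) /\ @q2 k s h (~` B (cur s)) = 0%E.
Hypothesis p_ge0 : forall i j u v, A i u -> B i v -> 0 <= prb G i j u v.

Let cur_rcons k (s : k.+1.-tuple 'I_n) j : cur [tuple of rcons s j] = j.
Proof.
by rewrite /cur (tnth_nth j)/= nth_rcons size_tuple ltnn eqxx.
Qed.

(** Induction on the number of remaining stages: [z] dominates each stage for all controls in A and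
    B, so the bound depends on the history through the current state only. A and B will be
    singletons for stationary policies and the admissible sets for an arbitrary opponent. *)
Lemma Vexp_le (z : nat -> 'I_n -> R) :
  (forall i, 0 <= z 0%N i) ->
  (forall t i u v, A i u -> B i v ->
    Defs.cst G i u v + \sum_(j < n) prb G i j u v * z t j <= z t.+1 i) ->
  forall m k s h, (@Vexp R n U V G q1 q2 m k s h <= (z m (cur s))%:E)%E.
Proof.
move=> z0 zS; elim=> [|m IHm] k s h /=; first by rewrite lee_fin.
have [P1 Q1] := q1A s h; have [P2 Q2] := q2B s h.
apply: (product_integral_le_on (mA (cur s)) (mB (cur s)) P1 P2 Q1 Q2).
move=> u v Au Bv /=; have := zS m _ _ _ Au Bv; rewrite -lee_fin; apply: le_trans.
rewrite EFinD leeD2l// -sumEFin lee_sum// => j _; rewrite EFinM.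
rewrite lee_wpmul2l ?lee_fin ?p_ge0//.
by rewrite -[X in z m X](cur_rcons s j); exact: IHm.
Qed.

Lemma Vexp_ge (z : nat -> 'I_n -> R) :
  (forall i, z 0%N i <= 0) ->
  (forall t i u v, A i u -> B i v ->
    z t.+1 i <= Defs.cst G i u v + \sum_(j < n) prb G i j u v * z t j) ->
  forall m k s h, ((z m (cur s))%:E <= @Vexp R n U V G q1 q2 m k s h)%E.
Proof.
move=> z0 zS; elim=> [|m IHm] k s h /=; first by rewrite lee_fin.
have [P1 Q1] := q1A s h; have [P2 Q2] := q2B s h.
apply: (product_integral_ge_on (mA (cur s)) (mB (cur s)) P1 P2 Q1 Q2).
move=> u v Au Bv /=; have := zS m _ _ _ Au Bv; rewrite -lee_fin => /le_trans; apply.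
rewrite EFinD leeD2l// -sumEFin lee_sum// => j _; rewrite EFinM.
rewrite lee_wpmul2l ?lee_fin ?p_ge0//.
by rewrite -[X in z m X](cur_rcons s j); exact: IHm.
Qed.

Let cur1 (i : 'I_n) : cur [tuple i] = i.
Proof. by rewrite /cur (tnth_nth i). Qed.

Lemma xc_le (z : nat -> 'I_n -> R) i (x : R) :
  (forall i, 0 <= z 0%N i) ->
  (forall t i u v, A i u -> B i v ->
    Defs.cst G i u v + \sum_(j < n) prb G i j u v * z t j <= z t.+1 i) ->
  z t i @[t --> \oo] --> x -> (xc G q1 q2 i <= x%:E)%E.
Proof.
move=> z0 zS zx; rewrite /xc -(limn_einf_EFin zx).
apply: limn_einf_le => t; rewrite -[X in z _ X](cur1 i).
by exact: Vexp_le z0 zS t.+1 0%N _ _.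
Qed.

Lemma xc_ge (z : nat -> 'I_n -> R) i (x : R) :
  (forall i, z 0%N i <= 0) ->
  (forall t i u v, A i u -> B i v ->
    z t.+1 i <= Defs.cst G i u v + \sum_(j < n) prb G i j u v * z t j) ->
  z t i @[t --> \oo] --> x -> (x%:E <= xc G q1 q2 i)%E.
Proof.
move=> z0 zS zx; rewrite /xc -(limn_einf_EFin zx).
apply: limn_einf_le => t; rewrite -[X in z _ X](cur1 i).
by exact: Vexp_ge z0 zS t.+1 0%N _ _.
Qed.

End expected_cost_bounds.

(** * Compactness through ultrafilters *)

Section ultrafilter_limits.
Context {I : Type} {F : set_system I} {FU : UltraFilter F}.

Lemma fmap_ultra T (f : I -> T) : UltraFilter (f @ F).
Proof.
split; first exact: fmap_proper_filter.
move=> G PG FG; apply/seteqP; split => // B GB.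
have [//|FC] := in_ultra_setVsetC (f @^-1` B) FU.
have : G set0 by rewrite -(setICr B); apply: filterI => //; exact: FG.
by move/filter_not_empty.
Qed.

(** Along an ultrafilter no subsequences are extracted: the controls of all states converge along
    the same filter. The target [within] fits continuity on the admissible sets. *)
Lemma ultra_cvg_within (T : topologicalType) (A : set T) (f : I -> T) :
  compact A -> (forall k, A (f k)) ->
  exists2 x, A x & f k @[k --> F] --> within A (nbhs x).
Proof.
move=> + Af; rewrite compact_ultra => /(_ (f @ F)) [||x [Ax fx]].
- exact: fmap_ultra.
- by apply: (@filterE _ F _ (fun k => A (f k))) => k; exact: Af.
exists x => // B /= /fx; rewrite /nbhs /fmap /=; apply: filterS => k; apply; exact: Af.
Qed.

Lemma ultra_cvg_itv (R : realType) (f : I -> R) (a b : R) :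
  (\forall k \near F, a <= f k <= b) -> exists y : R, f k @[k --> F] --> y.
Proof.
move=> fab.
have := segment_compact (a := a) (b := b); rewrite compact_ultra.
move=> /(_ (f @ F)) [||y [_ fy]]; last by exists y.
- exact: fmap_ultra.
- by apply: filterS fab => k; rewrite /= in_itv.
Qed.

End ultrafilter_limits.

(** The sublevel sets through points of A form a filter base. Its cluster point is a minimizer: a
    value above some [f y] would persist nearby and miss the sublevel set of [y]. *)
Lemma lsc_min (R : realType) (T : topologicalType) (A : set T) (f : T -> R) :
  compact A -> A !=set0 ->
  (forall x a, A x -> a < f x -> \forall y \near within A (nbhs x), a < f y) ->
  exists2 x, A x & forall y, A y -> f x <= f y.
Proof.
move=> cA [x0 Ax0] lscf.
pose F := filter_from A (fun z => A `&` [set y | f y <= f z]).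
have FF : ProperFilter F.
  apply: filter_from_proper; last by move=> z Az; exists z; split => /=.
  apply: filter_from_filter; first by exists x0.
  move=> y z Ay Az; have [yz|zy] := leP (f y) (f z).
    by exists y => // t [At ty]; split; split => //; exact: le_trans yz.
  by exists z => // t [At tz]; split; split => //; apply: le_trans tz (ltW zy).
have [|x [Ax xF]] := cA F FF; first by exists x0 => // t [].
exists x => // y Ay; rewrite leNgt; apply/negP => yx.
have := lscf _ _ Ax yx; rewrite /within/= => nx.
have Fy : F (A `&` [set t | f t <= f y]) by exists y.
have [t [[At ty] /(_ At)]] := xF _ _ Fy nx.
by rewrite ltNge ty.
Qed.

(** * Exchange of the players *)

(* Only the notions not involving xSD are transported along swap_game: xSD is a
   liminf, which is not exchanged with itself by a change of sign. *)
Definition swap_game (R : realType) n (U V : completePseudoMetricType R)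
    (G : game n U V) : game n V U :=
  Game (Vbar G) (Ubar G) (fun i v u => - Defs.cst G i u v)
    (fun i j v u => prb G i j u v).

(** The Continuity Condition read one control at a time, in a form that the exchange of the players
    preserves. *)
Definition semicontinuous_game (R : realType) n (U V : completePseudoMetricType R)
    (G : game n U V) :=
  [/\ forall i j u v, Ubar G i u -> Vbar G i v ->
        prb G i j u v' @[v' --> within (Vbar G i) (nbhs v)] --> prb G i j u v,
      forall i j u v, Ubar G i u -> Vbar G i v ->
        prb G i j u' v @[u' --> within (Ubar G i) (nbhs u)] --> prb G i j u v,
      forall i u v a, Ubar G i u -> Vbar G i v -> Defs.cst G i u v < a ->
        \forall v' \near within (Vbar G i) (nbhs v), Defs.cst G i u v' < a &
      forall i u v a, Ubar G i u -> Vbar G i v -> a < Defs.cst G i u v ->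
        \forall u' \near within (Ubar G i) (nbhs u), a < Defs.cst G i u' v].

Section swap.
Context (R : realType) n (U V : completePseudoMetricType R) (G : game n U V).

Lemma swap_game_model : game_model G -> game_model (swap_game G).
Proof. by move=> [cU [cV H]]; split => //; split => // i v u Vv Uu; exact: H. Qed.

Lemma swap_semicontinuous : semicontinuous_game G ->
  semicontinuous_game (swap_game G).
Proof.
move=> [pV pU usc lsc]; split => /= i; first by move=> *; exact: pU.
- by move=> *; exact: pV.
- move=> v u a Vv Uu; rewrite ltrNl => /(lsc _ _ _ _ Uu Vv).
  by apply: filterS => u'; rewrite ltrNl.
- move=> v u a Vv Uu; rewrite ltrNr => /(usc _ _ _ _ Uu Vv).
  by apply: filterS => u'; rewrite ltrNr.
Qed.

Lemma Tmn_swap mu nu (x : 'I_n -> R) i :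
  Tmn (swap_game G) nu mu x i = - Tmn G mu nu (fun j => - x j) i.
Proof.
rewrite /Tmn/= opprD; congr (_ + _); rewrite -sumrN.
by apply: eq_bigr => j _; rewrite mulrN opprK.
Qed.

Lemma alive_swap mu nu t i : alive (swap_game G) nu mu t i = alive G mu nu t i.
Proof. by elim: t i => //= t IH i; apply: eq_bigr => j _; rewrite IH. Qed.

Lemma nonprolonging_swap mu nu :
  nonprolonging (swap_game G) nu mu <-> nonprolonging G mu nu.
Proof.
rewrite /nonprolonging (_ : alive (swap_game G) nu mu = alive G mu nu)//.
by apply/funext => t; apply/funext => i; exact: alive_swap.
Qed.

End swap.

(** * Markov chains of stationary pairs *)

Section transient.
Context (R : realType) n (U V : completePseudoMetricType R) (G : game n U V).
Hypothesis GM : game_model G.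
Variables (mu : 'I_n -> U) (nu : 'I_n -> V).
Hypotheses (mu1 : SD1 G mu) (nu2 : SD2 G nu).
Local Notation P i j := (prb G i j (mu i) (nu i)).

Lemma prb_ge0 i j : 0 <= P i j.
Proof. by have [_ [_ /(_ i _ _ (mu1 i) (nu2 i)) []]] := GM. Qed.

Lemma prb_le1 i : \sum_j P i j <= 1.
Proof. by have [_ [_ /(_ i _ _ (mu1 i) (nu2 i)) []]] := GM. Qed.

Lemma alive_ge0 t i : 0 <= alive G mu nu t i.
Proof.
elim: t i => //= t IH i; apply: sumr_ge0 => j _.
by rewrite mulr_ge0// prb_ge0.
Qed.

Lemma Tmn_le x y i : (forall j, x j <= y j) -> Tmn G mu nu x i <= Tmn G mu nu y i.
Proof.
move=> xy; rewrite lerD2l ler_sum// => j _.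
by rewrite ler_wpM2l// prb_ge0.
Qed.

Lemma Tmn_shift x (a : R) i : 0 <= a ->
  Tmn G mu nu (fun j => x j + a) i <= Tmn G mu nu x i + a.
Proof.
move=> a0; rewrite /Tmn -addrA lerD2l.
under eq_bigr do rewrite mulrDr.
by rewrite big_split/= -mulr_suml lerD2l ler_piMl// prb_le1.
Qed.

(** Iterating z <= P z gives z <= M P^t 1, and P^t 1 tends to 0. *)
Lemma nonprolonging_le0 (z : 'I_n -> R) : nonprolonging G mu nu ->
  (forall i, z i <= \sum_j P i j * z j) -> forall i, z i <= 0.
Proof.
move=> np zP i; pose M : R := \sum_j `|z j|.
have zM t j : z j <= M * alive G mu nu t j.
  elim: t j => [|t IH] j /=.
    rewrite mulr1 /M (bigD1 j)//=; apply: le_trans (ler_norm _) _.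
    by rewrite lerDl sumr_ge0.
  apply: le_trans (zP j) _; rewrite mulr_sumr ler_sum// => l _.
  by rewrite mulrCA ler_wpM2l// prb_ge0.
have Mc : M * alive G mu nu t i @[t --> \oo] --> M * 0 by exact: cvgMl_tmp (np i).
rewrite mulr0 in Mc; apply: (cvgr_to_ge Mc).
by apply: nearW => t.
Qed.

(** Choose t with P^t 1 <= 1/2 and take w = -L (1 + P 1 + ... + P^(t-1) 1). Telescoping gives P w -
    w = L (1 - P^t 1) >= L/2, and L/2 dominates every |c_i|. *)
Lemma nonprolonging_sub : nonprolonging G mu nu ->
  exists w, forall i, w i <= Tmn G mu nu w i.
Proof.
move=> np.
have [t tP] : exists t, forall i, alive G mu nu t i <= 2^-1.
  suff [t _ tP] : \forall t \near \oo, forall i, alive G mu nu t i <= 2^-1.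
    by exists t => i; apply: (tP t); rewrite /= leqnn.
  apply: filter_forall => i; apply: cvgr_le (np i) _ _.
  by rewrite invr_gt0.
pose L : R := 2 * \sum_i `|Defs.cst G i (mu i) (nu i)|.
exists (fun i => - L * \sum_(m < t) alive G mu nu m i) => i.
rewrite /Tmn/=.
have -> : \sum_j P i j * (- L * \sum_(m < t) alive G mu nu m j) = 
    - L * (\sum_(m < t) alive G mu nu m i - 1 + alive G mu nu t i).
  under eq_bigr do rewrite mulrCA; rewrite -mulr_sumr; congr (_ * _).
  under eq_bigr do rewrite mulr_sumr; rewrite exchange_big/=.
  rewrite addrAC; apply/eqP; rewrite -subr_eq opprK; apply/eqP.
  have -> : 1 = alive G mu nu 0 i by [].
  rewrite -(big_ord_recr t (fun m : 'I_t.+1 => alive G mu nu m i)) big_ord_recl addrC.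
by congr (_ + _); apply: eq_bigr => m _.
have cL : 2 * `|Defs.cst G i (mu i) (nu i)| <= L.
  by rewrite ler_pM2l// (bigD1 i)//= lerDl sumr_ge0.
have := ler_norm (- Defs.cst G i (mu i) (nu i)); rewrite normrN.
have := normr_ge0 (Defs.cst G i (mu i) (nu i)).
move: (tP i) cL; set x := `|_|; set a := alive _ _ _ _ _.
set y := Defs.cst _ _ _ _; set S := \sum_(_ < t) _ => ta cL x0 yx.
(* Two products for the nonlinear part: L (1 - a) >= 2 x (1 - a) >= x. *)
have : 0 <= (L - 2 * x) * (1 - a) by apply: mulr_ge0; lra.
have : 0 <= x * (2^-1 - a) by apply: mulr_ge0; lra.
lra.
Qed.

End transient.

(** * Boundedness of subsolutions *)

Section bounded_subsolutions.
Context (R : realType) n (U V : completePseudoMetricType R) (G : game n U V).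
Hypothesis GM : game_model G.
Hypothesis GC : semicontinuous_game G.
Variable mu : 'I_n -> U.
Hypothesis mu1 : SD1 G mu.

Let c i v := Defs.cst G i (mu i) v.
Let p i j v := prb G i j (mu i) v.

Let p_ge0 i j v : Vbar G i v -> 0 <= p i j v.
Proof. by move=> Vv; have [_ [_ H]] := GM; exact: (H i _ _ (mu1 i) Vv).1. Qed.

Let p_le1 i v : Vbar G i v -> \sum_j p i j v <= 1.
Proof. by move=> Vv; have [_ [_ H]] := GM; exact: (H i _ _ (mu1 i) Vv).2. Qed.

Section blow_up.
Variables (nu_ : nat -> 'I_n -> V) (x_ : nat -> 'I_n -> R) (top : nat -> 'I_n).
Hypothesis nu2 : forall k, SD2 G (nu_ k).
Hypothesis sub : forall k i, x_ k i <= Tmn G mu (nu_ k) (x_ k) i.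
Hypothesis x_top : forall k i, x_ k i <= x_ k (top k).
Hypothesis x_big : forall k, k%:R < x_ k (top k).

Let d k i := x_ k i - x_ k (top k).
(** The maximum times the probability of termination: the price of subtracting the maximum from a
    subsolution. *)
Let leak k i := x_ k (top k) * (1 - \sum_j p i j (nu_ k i)).

Let d_le0 k i : d k i <= 0. Proof. by rewrite subr_le0. Qed.

Let top_ge0 k : 0 <= x_ k (top k).
Proof. by apply: ltW; apply: le_lt_trans (x_big k); exact: ler0n. Qed.

Let leak_ge0 k i : 0 <= leak k i.
Proof. by rewrite mulr_ge0// subr_ge0 p_le1//; exact: nu2. Qed.

Let d_sub k i :
  d k i <= c i (nu_ k i) + \sum_j p i j (nu_ k i) * d k j - leak k i.
Proof.
rewrite /d lerBlDr; apply: le_trans (sub k i) _.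
rewrite /Tmn -/(c i (nu_ k i)).
under [in leRHS]eq_bigr do rewrite mulrBr.
rewrite sumrB -mulr_suml /leak /p; lra.
Qed.

(* J collects the states whose values stay within bounded distance of the
   maximum.  The limit policy never leaves J: an escape probability would be
   multiplied by an unbounded loss.  On J, y is the limit of the values minus
   their maximum. *)
Lemma blow_up_limit : exists (J : 'I_n -> bool) (nu : 'I_n -> V) (y : 'I_n -> R),
  [/\ SD2 G nu, exists i, J i, forall i, J i -> \sum_(j | J j) p i j (nu i) = 1 &
   forall i, J i -> y i <= c i (nu i) + \sum_(j | J j) p i j (nu i) * y j].
Proof.
(* One ultrafilter refining [\oo] makes all controls, transition probabilities and bounded
   differences converge together. *)
have [F [FU ooF]] := ultraFilterLemma eventually_filter.
have [pV _ usc _] := GC.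
have /choice[nu nuP] : forall i, exists v, Vbar G i v /\
    nu_ k i @[k --> F] --> within (Vbar G i) (nbhs v).
  move=> i; have cV : compact (Vbar G i) by have [_ []] := GM.
  have [v Vv nv] := @ultra_cvg_within _ F FU _ _ (nu_ ^~ i) cV (nu2 ^~ i).
  by exists v.
have Vnu i : Vbar G i (nu i) by have [] := nuP i.
have cvg_p i j : p i j (nu_ k i) @[k --> F] --> p i j (nu i).
  exact: cvg_comp (nuP i).2 (pV _ _ _ _ (mu1 i) (Vnu i)).
have cvg_c i a : c i (nu i) < a -> \forall k \near F, c i (nu_ k i) < a.
  by move=> /(usc _ _ _ _ (mu1 i) (Vnu i)) /((nuP i).2).
have top_oo (M : R) : \forall k \near F, M <= x_ k (top k).
  apply: ooF; apply: filterS (nbhs_infty_ger M) => k Mk.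
  by apply: le_trans Mk _; exact: ltW.
pose J i := `[< exists M : R, \forall k \near F, - M <= d k i >].
have JN i : ~~ J i -> forall M : R, \forall k \near F, d k i < - M.
  move=> /asboolPn nJ M.
  have [FM|] := in_ultra_setVsetC [set k | - M <= d k i] FU.
    by exfalso; apply: nJ; exists M.
  by apply: filterS => k /= /negP; rewrite -ltNge.
have /choice[y yP] : forall i, exists y : R, J i -> d k i @[k --> F] --> y.
  move=> i; have [Ji|_] := boolP (J i); last by exists 0.
  have /asboolP[M FM] := Ji.
  have [|y dy] := @ultra_cvg_itv _ F FU R (d^~ i) (- M) 0.
    by apply: filterS FM => k ->; rewrite d_le0.
  by exists y.
(* Since [d] vanishes at [top k], the finitely many states cannot all have negative [d] at a common
   k. *)
have exJ : exists i, J i.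
  apply: contrapT => nJ.
  have : \forall k \near F, forall i, d k i < - 0.
    apply: filter_forall => i; apply: JN; apply/negP => Ji.
    by apply: nJ; exists i.
  by move=> /filter_ex[k /(_ (top k))]; rewrite /d subrr oppr0 ltxx.
(* On J the left side of [d_sub] is bounded below and the cost is bounded above by upper
   semicontinuity. The remaining terms are all nonpositive, so each of them is bounded. *)
have term_bound i : J i -> exists M : R, 0 < M /\ \forall k \near F,
    (forall j, - M <= p i j (nu_ k i) * d k j) /\ leak k i <= M.
  move=> /asboolP[M FM].
  have cb : \forall k \near F, c i (nu_ k i) < c i (nu i) + 1.
    by apply: cvg_c; rewrite ltrDl.
  exists (`|M| + `|c i (nu i)| + 1); split.
    by rewrite ltr_pwDr// addr_ge0.
  near=> k.
  have Mk : - M <= d k i by near: k.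
  have ck : c i (nu_ k i) < c i (nu i) + 1 by near: k.
  have := d_sub k i; have := leak_ge0 k i.
  have := ler_norm M; have := ler_norm (c i (nu i)).
  have t0 j : p i j (nu_ k i) * d k j <= 0.
    by rewrite mulr_ge0_le0// p_ge0//; exact: nu2.
  have : \sum_j p i j (nu_ k i) * d k j <= 0 by exact: sumr_le0.
  move=> S0 cn Mn l0 ds; split; last by lra.
  move=> j; move: ds; rewrite (bigD1 j)//=.
  have : \sum_(l | l != j) p i l (nu_ k i) * d k l <= 0 by exact: sumr_le0.
  lra.
have small (a : R) (M : R) : 0 <= M -> (forall K : R, 0 < K -> a * K <= M) -> a <= 0.
  move=> M0 aK; rewrite leNgt; apply/negP => a0.
  have := aK ((M + 1) / a); rewrite mulrCA divff ?gt_eqF// mulr1.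
  by move=> /(_ (divr_gt0 _ a0)); rewrite ltr_wpDl// => /(_ isT); lra.
(* Here [p * d >= - M] while [d] falls below every -K, so p K <= M in the limit for every K. *)
have stay i j : J i -> ~~ J j -> p i j (nu i) = 0.
  move=> Ji /JN dj; have [M [M0 FM]] := term_bound i Ji.
  apply/eqP; rewrite eq_le p_ge0 ?andbT//; apply: (small _ M (ltW M0)) => K K0.
  have h : p i j (nu_ k i) * K @[k --> F] --> p i j (nu i) * K.
    exact: cvgMr_tmp (cvg_p i j).
  apply: (cvgr_to_le h); near=> k.
  have [/(_ j) Mk _] : (forall j, - M <= p i j (nu_ k i) * d k j) /\ leak k i <= M.
    by near: k.
  have dK : d k j < - K by near: k; exact: dj.
  have : p i j (nu_ k i) * (d k j + K) <= 0.
    by rewrite mulr_ge0_le0 ?p_ge0//; [exact: nu2|lra].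
  lra.
(* The leak stays below M while the maximum tends to infinity, so the limit probability of
   termination is 0. *)
have closed i : J i -> \sum_j p i j (nu i) = 1.
  move=> Ji; have [M [M0 FM]] := term_bound i Ji.
  apply/eqP; rewrite eq_le p_le1//= -subr_le0.
  apply: (small _ M (ltW M0)) => K K0.
  have h : (1 - \sum_j p i j (nu_ k i)) * K @[k --> F] -->
      (1 - \sum_j p i j (nu i)) * K.
    apply: cvgMr_tmp; apply: cvgB; first exact: cvg_cst.
    by apply: cvg_big => [|j Jj]; [exact: add_continuous|]; exact: cvg_p.
  apply: (cvgr_to_le h); near=> k.
  have [_ lk] : (forall j, - M <= p i j (nu_ k i) * d k j) /\ leak k i <= M.
    by near: k.
  apply: le_trans lk; rewrite /leak mulrC ler_wpM2r ?subr_ge0 ?p_le1//; first exact: nu2.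
  by near: k; exact: top_oo.
exists J, nu, y; split => //.
  move=> i Ji; rewrite -[RHS](closed i Ji) [RHS](bigID J)/=.
  by rewrite [X in _ + X]big1 ?addr0// => j nJj; exact: stay.
(* The costs are only upper semicontinuous, so the inequality passes to the limit with a margin
   e. *)
move=> i Ji; apply/ler_addgt0Pr => e e0.
have h : c i (nu i) + e + \sum_(j | J j) p i j (nu_ k i) * d k j @[k --> F] -->
    c i (nu i) + e + \sum_(j | J j) p i j (nu i) * y j.
  apply: cvgD; first exact: cvg_cst.
  apply: cvg_big => [|j Jj]; first exact: add_continuous.
  by apply: cvgM; [exact: cvg_p|exact: yP].
rewrite addrAC; apply: ler_cvg_to (yP i Ji) h _.
near=> k.
have ck : c i (nu_ k i) < c i (nu i) + e by near: k; apply: cvg_c; rewrite ltrDl.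
apply: le_trans (d_sub k i) _; rewrite (bigID J)/=.
have : \sum_(j | ~~ J j) p i j (nu_ k i) * d k j <= 0.
  by apply: sumr_le0 => j _; rewrite mulr_ge0_le0 ?p_ge0//; exact: nu2.
have := leak_ge0 k i; lra.
Unshelve. all: by end_near. Qed.

End blow_up.

Lemma subsolutions_bounded :
  (forall nu, SD2 G nu -> (exists y, forall i, y i <= Tmn G mu nu y i) ->
     nonprolonging G mu nu) ->
  (exists2 nu0, SD2 G nu0 & nonprolonging G mu nu0) ->
  exists K : R, forall nu x, SD2 G nu -> (forall i, x i <= Tmn G mu nu x i) ->
    forall i, x i <= K.
Proof.
move=> sub_np [nu0 nu02 np0]; apply: contrapT => unbounded.
have /choice[s sP] : forall k : nat, exists s : ('I_n -> V) * ('I_n -> R) * 'I_n,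
    [/\ SD2 G s.1.1, forall i, s.1.2 i <= Tmn G mu s.1.1 s.1.2 i,
        forall i, s.1.2 i <= s.1.2 s.2 & k%:R < s.1.2 s.2].
  move=> k; apply: contrapT => nk; apply: unbounded; exists k%:R => nu x nu2 xT i.
  rewrite leNgt; apply/negP => kx; apply: nk.
  have [m _ mP] := @arg_maxP _ _ _ i predT x isT.
  exists (nu, x, m); split => //= [j|]; first exact: mP.
  exact: lt_le_trans kx (mP i isT).
have [|||k|J [nu [y [nu2 [i0 Ji0] closed yT]]]] :=
  @blow_up_limit (fun k => (s k).1.1) (fun k => (s k).1.2) (fun k => (s k).2).
- by move=> k; have [] := sP k.
- by move=> k; have [] := sP k.
- by move=> k; have [] := sP k.
- by have [] := sP k.
have [w wT] := nonprolonging_sub np0.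
(* The shift by L puts w - L below y, so replacing w - L by y on J only raises the right-hand side
   at the other states. *)
pose L : R := \sum_i (`|w i| + `|y i|).
have L0 : 0 <= L by apply: sumr_ge0 => i _; rewrite addr_ge0.
have wLy i : w i - L <= y i.
  have : `|w i| + `|y i| <= L.
    by rewrite /L (bigD1 i)//= lerDl sumr_ge0// => j _; rewrite addr_ge0.
  have := ler_norm (w i); have := ler_norm (- y i); rewrite normrN; lra.
pose nu' i := if J i then nu i else nu0 i.
pose y' i := if J i then y i else w i - L.
have nu'2 : SD2 G nu' by move=> i; rewrite /nu'; case: ifP.
have : nonprolonging G mu nu'.
  apply: sub_np => //; exists y' => i; rewrite /Tmn /nu' /y'.
  have [Ji|nJi] := boolP (J i).
    apply: le_trans (yT i Ji) _; rewrite lerD2l [leRHS](bigID J)/=.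
    rewrite [X in _ <= _ + X]big1 ?addr0 => [|j nJj].
      by apply: ler_sum => j ->.
    rewrite (negbTE nJj).
    have := closed i Ji; have := p_le1 (nu2 i); rewrite (bigID J)/= => + e.
    rewrite e gerDl => S0.
    have P0 : \sum_(l | ~~ J l) p i l (nu i) = 0.
      by apply/eqP; rewrite eq_le S0 sumr_ge0// => l _; exact: p_ge0.
    have := psumr_eq0P (fun l _ => p_ge0 l (nu2 i)) P0 nJj.
    by rewrite /p => ->; rewrite mul0r.
  have : Tmn G mu nu0 w i - L <= Tmn G mu nu0 (fun j => w j - L) i.
    rewrite /Tmn -addrA lerD2l; under [leRHS]eq_bigr do rewrite mulrBr.
    by rewrite sumrB lerD2l lerN2 -mulr_suml ler_piMl// prb_le1.
  have := wT i; have : Tmn G mu nu0 (fun j => w j - L) i <= Tmn G mu nu0 y' i.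
    by apply: Tmn_le => // j; rewrite /y'; case: ifP.
  rewrite /Tmn; lra.
(* Started in J, the glued policy never terminates: [alive] stays at least 1. *)
move=> /(_ i0) np; have : (1 : R) <= 0; last by rewrite ler10.
apply: (cvgr_to_ge np); apply: nearW => t.
elim: t i0 Ji0 {np} => //= t IH i Ji.
rewrite (bigID J)/= -[leLHS]addr0 lerD//; last first.
  by apply: sumr_ge0 => j _; rewrite mulr_ge0 ?prb_ge0 ?alive_ge0.
rewrite -(closed i Ji) ler_sum// => j Jj.
rewrite /nu' Ji -[leLHS]mulr1 ler_wpM2l//; first exact: p_ge0.
exact: IH.
Qed.

End bounded_subsolutions.

(** * Fixed points of monotone operators *)

Section monotone_operators.
Context (R : realType) n (F : ('I_n -> R) -> 'I_n -> R).
Hypothesis F_mono : forall x y, (forall i, x i <= y i) -> forall i, F x i <= F y i.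

(** Knaster-Tarski: the pointwise infimum y of the supersolutions is again one, hence so is F y, and
    y <= F y by minimality. *)
Lemma least_supersolution (K : R) :
  (exists x, forall i, F x i <= x i) ->
  (forall x, (forall i, F x i <= x i) -> forall i, K <= x i) ->
  exists y, forall i, F y i = y i.
Proof.
move=> [x0 x0P] KP.
pose S i := [set r | exists2 x, (forall i, F x i <= x i) & r = x i].
have hS i : has_inf (S i).
  by split; [exists (x0 i), x0|exists K => _ [x xP ->]; exact: KP].
pose y i := inf (S i).
have yle x : (forall i, F x i <= x i) -> forall i, y i <= x i.
  by move=> xP i; apply: ge_inf; [exact: (hS i).2|exists x].
have Fy i : F y i <= y i.
  apply: lb_le_inf; first exact: (hS i).1.
  move=> _ [x xP ->]; apply: le_trans (xP i).
  by apply: F_mono; exact: yle.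
exists y => i; apply/eqP; rewrite eq_le Fy/=.
by apply: (yle (F y)) => j; exact: F_mono.
Qed.

Hypothesis F_shift : forall x (a : R) i, 0 <= a ->
  F (fun j => x j + a) i <= F x i + a.

(** The iterates decrease to a limit y. In place of continuity, [F_shift] gives y <= F (y + e) <= F
    y + e, as the iterates are eventually below y + e at all of the finitely many states. *)
Lemma iter_supersolution_cvg x0 (K : R) :
  (forall i, F x0 i <= x0 i) -> (forall t i, K <= iter t F x0 i) ->
  exists y, [/\ forall i, F y i = y i, forall t i, y i <= iter t F x0 i &
    forall i, iter t F x0 i @[t --> \oo] --> y i].
Proof.
move=> x0P KP.
have step t i : iter t.+1 F x0 i <= iter t F x0 i.
  by elim: t i => [|t IH] i //=; exact: F_mono.
have dec i : nonincreasing_seq (fun t => iter t F x0 i).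
  by apply/nonincreasing_seqP => t; exact: step.
have lb i : has_lbound (range (fun t => iter t F x0 i)).
  by exists K => _ [t _ <-].
pose y i := inf (range (fun t => iter t F x0 i)).
have cvy i : iter t F x0 i @[t --> \oo] --> y i by exact: nonincreasing_cvgn.
have yle t i : y i <= iter t F x0 i by apply: ge_inf => //; exists t.
exists y; split => // i; apply/eqP; rewrite eq_le; apply/andP; split.
  apply: (cvgr_to_ge (cvy i)); exists 1%N => // -[//|t] _ /=.
  by apply: F_mono => j; exact: yle.
apply/ler_addgt0Pr => e e0.
have [t _ tP] : \forall t \near \oo, forall j, iter t F x0 j <= y j + e.
  by apply: filter_forall => j; apply: cvgr_le (cvy j) _ _; rewrite ltrDl.
apply: le_trans (yle t.+1 i) _ => /=.
apply: le_trans (F_shift y i (ltW e0)); apply: F_mono => j.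
by apply: (tP t) => /=.
Qed.

End monotone_operators.

(** * Attained extrema in the one-stage operators *)

Section one_stage_game.
Context (R : realType) n (U V : completePseudoMetricType R) (G : game n U V).
Hypothesis GM : game_model G.
Hypothesis GC : semicontinuous_game G.
Variables (mub : 'I_n -> U) (nub : 'I_n -> V).
Hypotheses (mub1 : SD1 G mub) (nub2 : SD2 G nub).

Let H i u v x : R := Defs.cst G i u v + \sum_j prb G i j u v * x j.

Let H_usc i u v x a : Ubar G i u -> Vbar G i v -> H i u v x < a ->
  \forall v' \near within (Vbar G i) (nbhs v), H i u v' x < a.
Proof.
have [pV _ usc _] := GC => Uu Vv Ha; pose e := (a - H i u v x) / 2.
have FP : ProperFilter (within (Vbar G i) (nbhs v)).
  by apply: within_nbhs_proper; exact: subset_closure.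
have e0 : 0 < e by rewrite divr_gt0// subr_gt0.
have cS : \sum_j prb G i j u v' * x j @[v' --> within (Vbar G i) (nbhs v)] -->
    \sum_j prb G i j u v * x j.
  apply: cvg_big => [|j _]; first exact: add_continuous.
  by apply: cvgMr_tmp; exact: pV.
near=> v'.
have : Defs.cst G i u v' < Defs.cst G i u v + e.
  by near: v'; apply: usc => //; rewrite ltrDl.
have : \sum_j prb G i j u v' * x j < \sum_j prb G i j u v * x j + e.
  by near: v'; apply: cvgr_lt cS _ _; rewrite ltrDl.
rewrite /H /e /H; lra.
Unshelve. all: by end_near. Qed.

Let H_lsc i u v x a : Ubar G i u -> Vbar G i v -> a < H i u v x ->
  \forall u' \near within (Ubar G i) (nbhs u), a < H i u' v x.
Proof.
have [_ pU _ lsc] := GC => Uu Vv Ha; pose e := (H i u v x - a) / 2.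
have FP : ProperFilter (within (Ubar G i) (nbhs u)).
  by apply: within_nbhs_proper; exact: subset_closure.
have e0 : 0 < e by rewrite divr_gt0// subr_gt0.
have cS : \sum_j prb G i j u' v * x j @[u' --> within (Ubar G i) (nbhs u)] -->
    \sum_j prb G i j u v * x j.
  apply: cvg_big => [|j _]; first exact: add_continuous.
  by apply: cvgMr_tmp; exact: pU.
near=> u'.
have : Defs.cst G i u v - e < Defs.cst G i u' v.
  by near: u'; apply: lsc => //; rewrite gtrBl.
have : \sum_j prb G i j u v * x j - e < \sum_j prb G i j u' v * x j.
  by near: u'; apply: cvgr_gt cS _ _; rewrite gtrBl.
rewrite /H /e /H; lra.
Unshelve. all: by end_near. Qed.

Let H_max i u x : Ubar G i u ->
  exists2 v, Vbar G i v & forall v', Vbar G i v' -> H i u v' x <= H i u v x.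
Proof.
move=> Uu; have cV : compact (Vbar G i) by have [_ []] := GM.
have [||v Vv vP] := @lsc_min R _ _ (fun v => - H i u v x) cV.
- by exists (nub i); exact: nub2.
- move=> v a Vv; rewrite ltrNr => /(H_usc Uu Vv).
  by apply: filterS => v'; rewrite ltrNr.
by exists v => // v' /vP; rewrite lerN2.
Qed.

(** The components of T_mu x decouple over the states, so maximizers chosen state by state form one
    policy attaining every supremum. *)
Lemma Tmu_max mu x : SD1 G mu ->
  exists2 nu, SD2 G nu & forall i, Tmu G mu x i = (Tmn G mu nu x i)%:E.
Proof.
move=> mu1.
have /choice[nu nuP] : forall i, exists v, Vbar G i v /\
    forall v', Vbar G i v' -> H i (mu i) v' x <= H i (mu i) v x.
  by move=> i; have [v Vv vP] := H_max x (mu1 i); exists v.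
exists nu => [i|i]; first exact: (nuP i).1.
apply/eqP; rewrite eq_le; apply/andP; split.
  apply: ge_ereal_sup => _ [nu' nu'2 <-]; rewrite lee_fin.
  by apply: (nuP i).2; exact: nu'2.
by apply: ereal_sup_ubound; exists nu => // j; exact: (nuP j).1.
Qed.

Lemma Tmn_le_Tmu mu nu x i : SD2 G nu -> ((Tmn G mu nu x i)%:E <= Tmu G mu x i)%E.
Proof. by move=> nu2; apply: ereal_sup_ubound; exists nu. Qed.

Lemma stage_le_Tmu mu v x i : Vbar G i v ->
  ((Defs.cst G i (mu i) v + \sum_j prb G i j (mu i) v * x j)%:E <= Tmu G mu x i)%E.
Proof.
move=> Vv; pose nu j := if j == i then v else nub j.
have nu2 : SD2 G nu by move=> j; rewrite /nu; case: eqP => [->|_].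
by have := Tmn_le_Tmu mu x i nu2; rewrite /Tmn/nu eqxx.
Qed.

(** The maximum over v is lower semicontinuous in u: if a < H(u, w u), then a < H(u', w u) <= H(u',
    w u') for u' near u. Minimizers at the single states are then assembled into a policy. *)
Lemma Top_min x : exists2 mu, SD1 G mu & forall i, Top G x i = Tmu G mu x i.
Proof.
have /choice[mu muP] : forall i, exists u, Ubar G i u /\
    forall mu, SD1 G mu -> forall mu', SD1 G mu' -> mu' i = u ->
      (Tmu G mu' x i <= Tmu G mu x i)%E.
  move=> i.
  have /choice[w wP] : forall u, exists v, Ubar G i u -> Vbar G i v /\
      forall v', Vbar G i v' -> H i u v' x <= H i u v x.
    move=> u; have [Uu|nUu] := pselect (Ubar G i u).
      by have [v Vv vP] := H_max x Uu; exists v.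
    by exists (nub i).
  have cU : compact (Ubar G i) by have [] := GM.
  have [||u Uu uP] := @lsc_min R _ _ (fun u => H i u (w u) x) cU.
  - by exists (mub i); exact: mub1.
  - move=> u a Uu /(H_lsc Uu (wP u Uu).1) au.
    apply: (@filterS _ (nbhs u) _ _ _ _ au) => u' h Uu'.
    apply: lt_le_trans (h Uu') _; apply: (wP u' Uu').2; exact: (wP u Uu).1.
  exists u; split => // mu mu1 mu' mu'1 mu'u.
  have [nu nu2 ->] := Tmu_max x mu'1; have [nu' nu'2 E] := Tmu_max x mu1.
  have := stage_le_Tmu mu x (wP _ (mu1 i)).1; apply: le_trans.
  rewrite lee_fin; apply: le_trans (uP _ (mu1 i)).
  by rewrite /Tmn mu'u; apply: (wP u Uu).2; exact: nu2.
have mu1 : SD1 G mu by move=> i; exact: (muP i).1.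
exists mu => // i; apply/eqP; rewrite eq_le; apply/andP; split.
  by apply: ereal_inf_lbound; exists mu.
by apply: le_ereal_inf_tmp => _ [mu' mu'1 <-]; exact: (muP i).2.
Qed.

Lemma Top_le_Tmu mu x i : SD1 G mu -> (Top G x i <= Tmu G mu x i)%E.
Proof. by move=> mu1; apply: ereal_inf_lbound; exists mu. Qed.

Definition Tmu_real mu x i : R := fine (Tmu G mu x i).
Definition Top_real x i : R := fine (Top G x i).

Lemma Tmu_realE mu x i : SD1 G mu -> Tmu G mu x i = (Tmu_real mu x i)%:E.
Proof. by move=> mu1; rewrite /Tmu_real; have [nu _ ->] := Tmu_max x mu1. Qed.

Lemma Top_realE x i : Top G x i = (Top_real x i)%:E.
Proof.
by rewrite /Top_real; have [mu mu1 ->] := Top_min x; rewrite Tmu_realE.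
Qed.

Lemma Tmu_real_mono mu x y : SD1 G mu -> (forall i, x i <= y i) ->
  forall i, Tmu_real mu x i <= Tmu_real mu y i.
Proof.
move=> mu1 xy i; rewrite -lee_fin -!Tmu_realE//.
have [nu nu2 ->] := Tmu_max x mu1; apply: le_trans (Tmn_le_Tmu _ _ _ nu2).
by rewrite lee_fin Tmn_le.
Qed.

Lemma Tmu_real_shift mu x (a : R) i : SD1 G mu -> 0 <= a ->
  Tmu_real mu (fun j => x j + a) i <= Tmu_real mu x i + a.
Proof.
move=> mu1 a0; rewrite -lee_fin EFinD -!Tmu_realE//.
have [nu nu2 ->] := Tmu_max (fun j => x j + a) mu1.
apply: le_trans (leeD (Tmn_le_Tmu _ _ _ nu2) (lexx _)).
by rewrite -EFinD lee_fin Tmn_shift.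
Qed.

Lemma Top_real_mono x y : (forall i, x i <= y i) ->
  forall i, Top_real x i <= Top_real y i.
Proof.
move=> xy i; rewrite -lee_fin -!Top_realE.
have [mu mu1 ->] := Top_min y; apply: le_trans (Top_le_Tmu _ _ mu1) _.
by rewrite !Tmu_realE// lee_fin Tmu_real_mono.
Qed.

End one_stage_game.

(** * Operators of the swapped game and fixed points *)

Section swapped_operators.
Context (R : realType) n (U V : completePseudoMetricType R) (G : game n U V).

Lemma Tmu_swap nu (x : 'I_n -> R) i :
  Tmu (swap_game G) nu x i = (- Tnu G nu (fun j => - x j)%R i)%E.
Proof.
rewrite /Tmu /Tnu /ereal_inf oppeK; congr ereal_sup.
rewrite image_comp; apply: eq_imagel => mu mu1 /=.
by rewrite Tmn_swap.
Qed.

Lemma Top_swap (x : 'I_n -> R) i :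
  Top (swap_game G) x i = (- Ttil G (fun j => - x j)%R i)%E.
Proof.
rewrite /Top /Ttil /ereal_inf; congr (- ereal_sup _)%E.
rewrite image_comp; apply: eq_imagel => nu nu2 /=.
by rewrite Tmu_swap oppeK.
Qed.

End swapped_operators.

Section fixed_points.
Context (R : realType) n (U V : completePseudoMetricType R) (G : game n U V).
Hypothesis GM : game_model G.
Hypothesis GC : semicontinuous_game G.

(** The fixed point is the greatest subsolution of T_mub. Conjugation by x -> -x makes it a least
    supersolution of [F], with [w] showing that one exists and K bounding them. *)
Lemma Tmu_fixed_point mub nub : SD1 G mub -> SD2 G nub ->
  nonprolonging G mub nub ->
  (forall nu, SD2 G nu -> (exists y, forall i, y i <= Tmn G mub nu y i) ->
     nonprolonging G mub nu) ->
  exists x, forall i, Tmu G mub x i = (x i)%:E.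
Proof.
move=> mub1 nub2 np sub_np.
have [|K KP] := subsolutions_bounded GM GC mub1 sub_np; first by exists nub.
have [w wT] := nonprolonging_sub np.
pose F x i := - Tmu_real G mub (fun j : 'I_n => - x j) i.
have [|||y yF] := @least_supersolution R n F _ (- K).
- move=> x y xy i; rewrite lerN2; apply: (Tmu_real_mono GM GC nub2 mub1) => j.
  by rewrite lerN2.
- exists (fun i => - w i) => i; rewrite lerN2.
  apply: le_trans (wT i) _; rewrite -lee_fin -(Tmu_realE GM GC nub2)//.
  by under [X in Tmu _ _ X]eq_fun do rewrite opprK; exact: Tmn_le_Tmu.
- move=> x Fx i; rewrite lerNl.
  have [nu nu2 E] := Tmu_max GM GC nub2 (fun j => - x j) mub1.
  apply: (KP nu (fun j => - x j)) => // j.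
  by rewrite -lee_fin -E (Tmu_realE GM GC nub2)// lee_fin lerNl; exact: Fx.
exists (fun j => - y j) => i.
by rewrite (Tmu_realE GM GC nub2)// -(yF i) opprK.
Qed.

End fixed_points.

Section supersolutions.
Context (R : realType) n (U V : completePseudoMetricType R) (G : game n U V).
Hypothesis GM : game_model G.
Hypothesis GC : semicontinuous_game G.

(** Negation turns supersolutions into subsolutions of the swapped game. *)
Lemma supersolutions_bounded nub : SD2 G nub ->
  (forall mu, SD1 G mu -> (exists y, forall i, Tmn G mu nub y i <= y i) ->
     nonprolonging G mu nub) ->
  (exists2 mu0, SD1 G mu0 & nonprolonging G mu0 nub) ->
  exists K : R, forall mu x, SD1 G mu -> (forall i, Tmn G mu nub x i <= x i) ->
    forall i, K <= x i.
Proof.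
move=> nub2 sup_np [mu0 mu01 np0].
have [||K KP] := @subsolutions_bounded _ _ _ _ (swap_game G)
    (swap_game_model GM) (swap_semicontinuous GC) nub nub2.
- move=> mu mu1 [y yP]; apply/nonprolonging_swap/sup_np => //.
  by exists (fun j => - y j) => i; have := yP i; rewrite Tmn_swap lerNr.
- by exists mu0 => //; exact/nonprolonging_swap.
exists (- K) => mu x mu1 xP i; rewrite lerNl.
apply: (KP mu (fun j => - x j)) => // j; rewrite Tmn_swap lerN2.
by under [X in Tmn _ _ _ X]eq_fun do rewrite opprK.
Qed.

(** A fixed point of T_mub is a supersolution of T. Any supersolution of T is, for its minimizing
    mu, one of T_{mu,nub}, hence bounded below. *)
Lemma Top_fixed_point mub nub : SD1 G mub -> SD2 G nub ->
  nonprolonging G mub nub ->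
  (forall nu, SD2 G nu -> (exists y, forall i, y i <= Tmn G mub nu y i) ->
     nonprolonging G mub nu) ->
  (forall mu, SD1 G mu -> (exists y, forall i, Tmn G mu nub y i <= y i) ->
     nonprolonging G mu nub) ->
  exists x : 'I_n -> R, forall i, Top G x i = (x i)%:E.
Proof.
move=> mub1 nub2 np sub_np sup_np.
have [x0 x0T] := Tmu_fixed_point GM GC mub1 nub2 np sub_np.
have [|K KP] := supersolutions_bounded nub2 sup_np; first by exists mub.
have [|||x xT] := @least_supersolution R n (Top_real G) _ K.
- by move=> x y; apply: (Top_real_mono GM GC mub1 nub2).
- exists x0 => i; rewrite -lee_fin -(Top_realE GM GC mub1 nub2) -x0T.
  exact: Top_le_Tmu.
- move=> x xT; have [mu mu1 E] := Top_min GM GC mub1 nub2 x.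
  apply: (KP mu) => // i; rewrite -lee_fin.
  apply: le_trans (Tmn_le_Tmu _ _ _ nub2) _.
  by rewrite -E (Top_realE GM GC mub1 nub2) lee_fin.
by exists x => i; rewrite (Top_realE GM GC mub1 nub2) xT.
Qed.

End supersolutions.

(** * Comparison and value iteration *)

Section value_iteration.
Context (R : realType) n (U V : completePseudoMetricType R) (G : game n U V).
Hypothesis GM : game_model G.
Hypothesis GC : semicontinuous_game G.
Hypothesis both_np : forall mu nu, SD1 G mu -> SD2 G nu ->
  (exists y, forall i, y i <= Tmn G mu nu y i) ->
  (exists y, forall i, Tmn G mu nu y i <= y i) -> nonprolonging G mu nu.

(** In z = y - x the costs cancel, leaving z <= P z for a non-prolonging pair. *)
Lemma sub_le_super mu nu x y : SD1 G mu -> SD2 G nu ->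
  (forall i, y i <= Tmn G mu nu y i) -> (forall i, Tmn G mu nu x i <= x i) ->
  forall i, y i <= x i.
Proof.
move=> mu1 nu2 yT xT i; rewrite -subr_le0.
have np : nonprolonging G mu nu by apply: both_np => //; [exists y|exists x].
apply: (nonprolonging_le0 GM mu1 nu2 (z := fun j => y j - x j) np) => j.
under eq_bigr do rewrite mulrBr; rewrite sumrB.
have := yT j; have := xT j; rewrite /Tmn; lra.
Qed.

(** The iterates of T_mu start at the supersolution x + L, where L makes it nonnegative, and
    decrease to a fixed point y >= x. For the maximizer nu at y, the vector y is a subsolution and x
    a supersolution of T_{mu,nu}, so y <= x. *)
Lemma upper_value_iteration mu nub x : SD1 G mu -> SD2 G nub ->
  (forall i, Tmu G mu x i = (x i)%:E) ->
  exists z : nat -> 'I_n -> R,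
  [/\ forall i, 0 <= z 0%N i,
      forall t i v, Vbar G i v -> Defs.cst G i (mu i) v +
        \sum_j prb G i j (mu i) v * z t j <= z t.+1 i &
      forall i, z t i @[t --> \oo] --> x i].
Proof.
move=> mu1 nub2 xT; pose F := Tmu_real G mu.
have Fx i : F x i = x i by rewrite /F /Tmu_real xT.
have F_mono := Tmu_real_mono GM GC nub2 mu1.
pose L : R := \sum_i `|x i|; have L0 : 0 <= L by exact: sumr_ge0.
have xL i : `|x i| <= L by rewrite /L (bigD1 i)//= lerDl sumr_ge0.
pose x0 i := x i + L.
have xle t : forall i, x i <= iter t F x0 i.
  elim: t => [|t IH] i /=; first by rewrite lerDl.
  by rewrite -[leLHS]Fx; exact: F_mono.
have [|||y [Fy _ cvy]] := @iter_supersolution_cvg R n F F_mono _ x0 (- L).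
- by move=> z a i; exact: Tmu_real_shift.
- move=> i; apply: le_trans (Tmu_real_shift GM GC nub2 _ _ mu1 L0) _.
  by rewrite -/F Fx.
- move=> t i; apply: le_trans (xle t i).
  by have := xL i; rewrite ler_norml => /andP[].
have yx i : y i = x i.
  apply/eqP; rewrite eq_le; apply/andP; split.
    have [nu nu2 E] := Tmu_max GM GC nub2 y mu1.
    apply: (sub_le_super mu1 nu2) => j.
      by rewrite -lee_fin -E (Tmu_realE GM GC nub2)// -/F Fy.
    by rewrite -lee_fin -xT; exact: Tmn_le_Tmu.
  by apply: (cvgr_to_ge (cvy i)); apply: nearW => t; exact: xle.
exists (fun t => iter t F x0); split.
- move=> i /=; have := xL i; rewrite ler_norml /x0 => /andP[]; lra.
- move=> t i v Vv /=; rewrite -lee_fin -(Tmu_realE GM GC nub2)//.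
  exact: (stage_le_Tmu nub2).
- by move=> i; rewrite -yx; exact: cvy.
Qed.

End value_iteration.

(** * Borel sets and the Continuity Condition *)

Lemma closed_measurable_Borel (R : realType) (T : completePseudoMetricType R)
    (A : set T) : closed A -> measurable (A : set (Borel T)).
Proof.
move=> cA; rewrite -[A]setCK; apply: measurableC.
by apply: sub_sigma_algebra; exact: closed_openC.
Qed.

Lemma set1_measurable_Borel (R : realType) (T : completePseudoMetricType R)
    (x : T) : hausdorff_space T -> measurable ([set x] : set (Borel T)).
Proof.
move=> hT; apply: closed_measurable_Borel; apply: accessible_closed_set1.
exact: hausdorff_accessible.
Qed.

Lemma continuity_semicontinuous (R : realType) n
    (U V : completePseudoMetricType R) (G : game n U V) :
  continuity_condition G -> semicontinuous_game G.
Proof.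
move=> GC; split => i.
- move=> j u v Uu Vv; have [/(_ j)/subspace_continuousP + _] := GC i.
  move=> /(_ (u, v) (conj Uu Vv)).
  apply: (cvg_trans _) => W [[P Q]/= [Pu Qv] PQW].
  apply: filterS Qv => v' Qv' Vv'; apply: (PQW (u, v')) => //.
  by split => //; exact: nbhs_singleton.
- move=> j u v Uu Vv; have [/(_ j)/subspace_continuousP + _] := GC i.
  move=> /(_ (u, v) (conj Uu Vv)).
  apply: (cvg_trans _) => W [[P Q]/= [Pu Qv] PQW].
  apply: filterS Pu => u' Pu' Uu'; apply: (PQW (u', v)) => //.
  by split => //; exact: nbhs_singleton.
- move=> u v a Uu Vv ca; have [_ [_ /(_ u Uu)/(_ v (- a))]] := GC i.
  rewrite EFinN lteN2 lte_fin => /(_ ca)[W].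
  move=> vW Wa; have {}vW : within (Vbar G i) (nbhs v) W.
    by rewrite (nbhs_subspace_in Vv); exact: vW.
  apply: filterS vW => v' /Wa.
  by rewrite lteN2 lte_fin.
- move=> u v a Uu Vv ca; have [_ [/(_ v Vv)/(_ u a) + _]] := GC i.
  rewrite lte_fin => /(_ ca)[W].
  move=> uW Wa; have {}uW : within (Ubar G i) (nbhs u) W.
    by rewrite (nbhs_subspace_in Uu); exact: uW.
  apply: filterS uW => u' /Wa.
  by rewrite lte_fin.
Qed.

(** * Costs of stationary policies *)

Section stationary_policies.
Context (R : realType) n (U V : completePseudoMetricType R) (G : game n U V).

(** A is left free to serve both the admissible sets, for membership in [Pi1], and the singletons,
    for sharp cost bounds. *)
Lemma stat1_dirac (mu : 'I_n -> U) (A : 'I_n -> set U) k (s : k.+1.-tuple 'I_n)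
    (h : projT2 (CT U V k)) :
  (forall i, A i (mu i)) ->
  is_prob (@stat1 R n U V mu k s h) /\ stat1 mu s h (~` A (cur s)) = 0%E.
Proof.
move=> Amu; split; first by exists (@dirac _ (Borel U) (mu (cur s)) R).
by rewrite /stat1 diracE memNset// => /(_ (Amu _)).
Qed.

Lemma stat2_dirac (nu : 'I_n -> V) (B : 'I_n -> set V) k (s : k.+1.-tuple 'I_n)
    (h : projT2 (CT U V k)) :
  (forall i, B i (nu i)) ->
  is_prob (@stat2 R n U V nu k s h) /\ stat2 nu s h (~` B (cur s)) = 0%E.
Proof.
move=> Bnu; split; first by exists (@dirac _ (Borel V) (nu (cur s)) R).
by rewrite /stat2 diracE memNset// => /(_ (Bnu _)).
Qed.

Lemma stat1_policy mu : SD1 G mu -> Pi1 G (stat1 mu).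
Proof.
move=> mu1 k s; split => [h|A mA]; last exact: measurable_cst.
exact: stat1_dirac.
Qed.

Lemma stat2_policy nu : SD2 G nu -> Pi2 G (stat2 nu).
Proof.
move=> nu2 k s; split => [h|B mB]; last exact: measurable_cst.
exact: stat2_dirac.
Qed.

Hypotheses (hU : hausdorff_space U) (hV : hausdorff_space V).
Hypothesis GM : game_model G.
Variables (mu : 'I_n -> U) (nu : 'I_n -> V).
Hypotheses (mu1 : SD1 G mu) (nu2 : SD2 G nu).

Let m1 i : measurable ([set mu i] : set (Borel U)).
Proof. exact: set1_measurable_Borel. Qed.

Let m2 i : measurable ([set nu i] : set (Borel V)).
Proof. exact: set1_measurable_Borel. Qed.

Let q1 k (s : k.+1.-tuple 'I_n) (h : projT2 (CT U V k)) :
  is_prob (@stat1 R n U V mu k s h) /\ stat1 mu s h (~` [set mu (cur s)]) = 0%E.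
Proof. exact: (stat1_dirac (A := fun i => [set mu i])). Qed.

Let q2 k (s : k.+1.-tuple 'I_n) (h : projT2 (CT U V k)) :
  is_prob (@stat2 R n U V nu k s h) /\ stat2 nu s h (~` [set nu (cur s)]) = 0%E.
Proof. exact: (stat2_dirac (B := fun i => [set nu i])). Qed.

Let p0 i j u v : [set mu i] u -> [set nu i] v -> 0 <= prb G i j u v.
Proof. by move=> -> ->; exact: prb_ge0. Qed.

(** Row sums are at most 1, so y - L is still a subsolution; being nonpositive, it bounds all
    partial sums from below. *)
Lemma xSD_gt_sub y : (forall i, y i <= Tmn G mu nu y i) ->
  forall i, (-oo < xSD G mu nu i)%E.
Proof.
move=> yT i; pose L : R := \sum_i `|y i|; have L0 : 0 <= L by exact: sumr_ge0.
have yL j : y j <= L.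
  by apply: le_trans (ler_norm _) _; rewrite /L (bigD1 j)//= lerDl sumr_ge0.
apply: (@lt_le_trans _ _ (y i - L)%:E); first exact: ltNyr.
apply: (xc_ge (A := fun i => [set mu i]) (B := fun i => [set nu i])
  m1 m2 q1 q2 p0 (z := fun _ i => y i - L)) => [j|t j u v -> ->|].
- by rewrite subr_le0.
- apply: le_trans (_ : Tmn G mu nu y j - L <= _); first by rewrite lerD2r.
  rewrite /Tmn -addrA lerD2l; under [leRHS]eq_bigr do rewrite mulrBr.
  rewrite sumrB lerD2l lerN2 -mulr_suml ler_piMl//.
  exact: prb_le1.
- exact: cvg_cst.
Qed.

Lemma xSD_lt_super y : (forall i, Tmn G mu nu y i <= y i) ->
  forall i, (xSD G mu nu i < +oo)%E.
Proof.
move=> yT i; pose L : R := \sum_i `|y i|; have L0 : 0 <= L by exact: sumr_ge0.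
have yL j : - y j <= L.
  rewrite (le_trans (ler_norm _))// normrN.
  by rewrite /L (bigD1 j)//= lerDl sumr_ge0.
apply: (@le_lt_trans _ _ (y i + L)%:E); last exact: ltry.
apply: (xc_le (A := fun i => [set mu i]) (B := fun i => [set nu i])
  m1 m2 q1 q2 p0 (z := fun _ i => y i + L)) => [j|t j u v -> ->|].
- by rewrite -lerBlDl sub0r.
- apply: le_trans (Tmn_shift GM mu1 nu2 y j L0) _.
  by rewrite lerD2r.
- exact: cvg_cst.
Qed.

End stationary_policies.

(** * Optimality against history-dependent policies *)

Section optimality.
Context (R : realType) n (U V : completePseudoMetricType R) (G : game n U V).
Hypothesis GM : game_model G.
Hypothesis GC : semicontinuous_game G.
Hypothesis both_np : forall mu nu, SD1 G mu -> SD2 G nu ->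
  (exists y, forall i, y i <= Tmn G mu nu y i) ->
  (exists y, forall i, Tmn G mu nu y i <= y i) -> nonprolonging G mu nu.
Hypotheses (hU : hausdorff_space U) (hV : hausdorff_space V).
Variables (mu : 'I_n -> U) (nu : 'I_n -> V) (x : 'I_n -> R).
Hypotheses (mu1 : SD1 G mu) (nu2 : SD2 G nu).

Let mU i : measurable (Ubar G i : set (Borel U)).
Proof.
by apply: closed_measurable_Borel; apply: compact_closed => //; have [] := GM.
Qed.

Let mV i : measurable (Vbar G i : set (Borel V)).
Proof.
by apply: closed_measurable_Borel; apply: compact_closed => //; have [_ []] := GM.
Qed.

Let mmu i : measurable ([set mu i] : set (Borel U)).
Proof. exact: set1_measurable_Borel. Qed.

Let mnu i : measurable ([set nu i] : set (Borel V)).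
Proof. exact: set1_measurable_Borel. Qed.

(** Value iteration bounds every stage uniformly over the opponent's admissible controls, hence also
    when they are randomized and depend on the history. *)
Lemma xc_le_Tmu_fixed : (forall i, Tmu G mu x i = (x i)%:E) ->
  forall p2, Pi2 G p2 -> forall i, (xc G (stat1 mu) p2 i <= (x i)%:E)%E.
Proof.
move=> xT p2 P2 i.
have [z [z0 zS zx]] := upper_value_iteration GM GC both_np mu1 nu2 xT.
have q1 := @stat1_dirac R n U V mu (fun i => [set mu i]).
have q2 k (s : k.+1.-tuple 'I_n) h := (P2 k s).1 h.
apply: (xc_le mmu mV _ q2 _ z0) (zx i) => [k s h|j l u v -> Vv|t j u v -> Vv].
- exact: q1.
- by have [_ [_ /(_ j _ _ (mu1 j) Vv)[]]] := GM.
- exact: zS.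
Qed.

Lemma xc_ge_Tnu_fixed : (forall i, Tnu G nu x i = (x i)%:E) ->
  forall p1, Pi1 G p1 -> forall i, ((x i)%:E <= xc G p1 (stat2 nu) i)%E.
Proof.
move=> xT p1 P1 i.
(* Value iteration runs in the swapped game; its negated iterates then bound [xc] in the original
   one. *)
have [||z [z0 zS zx]] := @upper_value_iteration _ _ _ _ (swap_game G)
  (swap_game_model GM) (swap_semicontinuous GC) _ nu mu (fun j => - x j) nu2 mu1.
- move=> nu' mu' nu'2 mu'1 [y yP] [w wP]; apply/nonprolonging_swap/both_np => //.
    by exists (fun j => - w j) => j; have := wP j; rewrite Tmn_swap lerNl.
  by exists (fun j => - y j) => j; have := yP j; rewrite Tmn_swap lerNr.
- move=> j; rewrite Tmu_swap (_ : (fun _ => _) = x) ?xT//.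
  by apply/funext => l; rewrite opprK.
have q2 := @stat2_dirac R n U V nu (fun i => [set nu i]).
have q1 k (s : k.+1.-tuple 'I_n) h := (P1 k s).1 h.
apply: (xc_ge (z := fun t j => - z t j) mU mnu q1 _ _ _ _ _)
  => [k s h|j l u v Uu ->|j|t j u v Uu ->|].
- exact: q2.
- by have [_ [_ /(_ j _ _ Uu (nu2 j))[]]] := GM.
- by rewrite oppr_le0.
- have := zS t j u Uu; rewrite /= lerNl opprD -sumrN.
  by under [in X in _ -> X]eq_bigr do rewrite mulrN opprK.
- by rewrite -[x i]opprK; apply: cvgN; exact: zx.
Qed.

End optimality.

(** * Saddle point, uniqueness and equilibrium *)

Theorem theorem2p1 (R : realType) (n : nat) (U V : completePseudoMetricType R)
    (G : @game R n U V) :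
  hausdorff_space U -> hausdorff_space V ->
  @separable_space U -> @separable_space V ->
  game_model G ->
  continuity_condition G ->
  minimax_regularity G ->
  SSP_assumption G ->
  exists xs : 'I_n -> R,
    (* finite value function *)
    (forall i, upper_value G i = (xs i)%:E /\ lower_value G i = (xs i)%:E) /\
    (* xs is the unique solution in R^n of x = T x *)
    (forall y : 'I_n -> R, (forall i, Top G y i = (y i)%:E) <-> (forall i, y i = xs i)) /\
    (* existence of stationary deterministic mu*, nu* with xs = T_mu* xs = T~_nu* xs *)
    (exists mu, exists nu, SD1 G mu /\ SD2 G nu /\
       forall i, Tmu G mu xs i = (xs i)%:E /\ Tnu G nu xs i = (xs i)%:E) /\
    (* properties of any such pair *)
    (forall mu nu, SD1 G mu -> SD2 G nu ->
       (forall i, Tmu G mu xs i = (xs i)%:E /\ Tnu G nu xs i = (xs i)%:E) ->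
       essentially_proper1 G mu /\ essentially_proper2 G nu /\
       nonprolonging G mu nu /\
       equilibrium G (stat1 mu) (stat2 nu) /\
       optimal1 G (stat1 mu) /\ optimal2 G (stat2 nu)).
Proof.
move=> hU hV _ _ GM /continuity_semicontinuous GC mmx [SSP1 [SSP2 SSP3]].
have [mub mub1 mubP] := SSP1; have [nub nub2 nubP] := SSP2.
have finite_np mu nu : SD1 G mu -> SD2 G nu ->
    (forall i, -oo < xSD G mu nu i)%E -> (forall i, xSD G mu nu i < +oo)%E ->
    nonprolonging G mu nu.
  move=> mu1 nu2 lo up; apply: contrapT => /(SSP3 _ _ mu1 nu2)[i [] E].
    by have := up i; rewrite E ltxx.
  by have := lo i; rewrite E ltxx.
(* Assumption (i) keeps the costs of this pair below +oo, and (ii) keeps them above -oo. *)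
have np : nonprolonging G mub nub.
  by apply: finite_np => // i; [exact: nubP|exact: mubP].
have both_np mu nu : SD1 G mu -> SD2 G nu ->
    (exists y, forall i, y i <= Tmn G mu nu y i) ->
    (exists y, forall i, Tmn G mu nu y i <= y i) -> nonprolonging G mu nu.
  move=> mu1 nu2 [y yP] [w wP]; apply: finite_np => //.
    exact: (xSD_gt_sub hU hV GM mu1 nu2 yP).
  exact: (xSD_lt_super hU hV GM mu1 nu2 wP).
have [||xs xsT] := Top_fixed_point GM GC mub1 nub2 np.
- move=> nu nu2 [y yP]; apply: finite_np => // i; last exact: mubP.
  exact: (xSD_gt_sub hU hV GM mub1 nu2 yP).
- move=> mu mu1 [y yP]; apply: finite_np => // i; first exact: nubP.
  exact: (xSD_lt_super hU hV GM mu1 nub2 yP).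
have saddle y : (forall i, Top G y i = (y i)%:E) -> exists mu nu,
    [/\ SD1 G mu, SD2 G nu, forall i, Tmu G mu y i = (y i)%:E &
        forall i, Tnu G nu y i = (y i)%:E].
  move=> yT; have [mu mu1 muT] := Top_min GM GC mub1 nub2 y.
  (* The maximizer for T~ is a minimizer in the swapped game; minimax regularity makes y a fixed
     point of T~ as well. *)
  have [nu nu2 nuT] := Top_min (swap_game_model GM) (swap_semicontinuous GC)
    nub2 mub1 (fun j => - y j).
  exists mu, nu; split => // i; first by rewrite -muT.
  have := nuT i; rewrite Top_swap Tmu_swap (_ : (fun _ => _) = y) => [|].
    by move/oppe_inj => <-; rewrite -mmx.
  by apply/funext => l; rewrite opprK.
have [mu [nu [mu1 nu2 muT nuT]]] := saddle xs xsT.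
have Tmn_le_fixed m v y : SD2 G v -> (forall i, Tmu G m y i = (y i)%:E) ->
    forall i, Tmn G m v y i <= y i.
  by move=> v2 yT i; rewrite -lee_fin -yT; exact: Tmn_le_Tmu.
have Tmn_ge_fixed m v y : SD1 G m -> (forall i, Tnu G v y i = (y i)%:E) ->
    forall i, y i <= Tmn G m v y i.
  by move=> m1 yT i; rewrite -lee_fin -yT; apply: ereal_inf_lbound; exists m.
have xc_le_xs m : SD1 G m -> (forall i, Tmu G m xs i = (xs i)%:E) ->
    forall p2, Pi2 G p2 -> forall i, (xc G (stat1 m) p2 i <= (xs i)%:E)%E.
  by move=> m1; exact: (xc_le_Tmu_fixed GM GC both_np hU hV m1 nu2).
have xc_ge_xs v : SD2 G v -> (forall i, Tnu G v xs i = (xs i)%:E) ->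
    forall p1, Pi1 G p1 -> forall i, ((xs i)%:E <= xc G p1 (stat2 v) i)%E.
  by move=> v2; exact: (xc_ge_Tnu_fixed GM GC both_np hU hV mu1 v2).
have sup_xs m : SD1 G m -> (forall i, Tmu G m xs i = (xs i)%:E) ->
    forall i, ereal_sup [set xc G (stat1 m) p2 i | p2 in Pi2 G] = (xs i)%:E.
  move=> m1 mT i; apply/eqP; rewrite eq_le; apply/andP; split.
    by apply: ge_ereal_sup => _ [p2 P2 <-]; exact: xc_le_xs.
  apply: le_trans (xc_ge_xs _ nu2 nuT _ (stat1_policy m1) i) _.
  by apply: ereal_sup_ubound; exists (stat2 nu) => //; exact: stat2_policy.
have inf_xs v : SD2 G v -> (forall i, Tnu G v xs i = (xs i)%:E) ->
    forall i, ereal_inf [set xc G p1 (stat2 v) i | p1 in Pi1 G] = (xs i)%:E.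
  move=> v2 vT i; apply/eqP; rewrite eq_le; apply/andP; split; last first.
    by apply: le_ereal_inf_tmp => _ [p1 P1 <-]; exact: xc_ge_xs.
  apply: le_trans _ (xc_le_xs _ mu1 muT _ (stat2_policy v2) i).
  by apply: ereal_inf_lbound; exists (stat1 mu) => //; exact: stat1_policy.
have upper i : upper_value G i = (xs i)%:E.
  apply/eqP; rewrite eq_le; apply/andP; split.
    rewrite -(sup_xs _ mu1 muT); apply: ereal_inf_lbound.
    by exists (stat1 mu) => //; exact: stat1_policy.
  apply: le_ereal_inf_tmp => _ [p1 P1 <-].
  apply: le_trans (xc_ge_xs _ nu2 nuT _ P1 i) _.
  by apply: ereal_sup_ubound; exists (stat2 nu) => //; exact: stat2_policy.
have lower i : lower_value G i = (xs i)%:E.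
  apply/eqP; rewrite eq_le; apply/andP; split; last first.
    rewrite -(inf_xs _ nu2 nuT); apply: ereal_sup_ubound.
    by exists (stat2 nu) => //; exact: stat2_policy.
  apply: ge_ereal_sup => _ [p2 P2 <-].
  apply: le_trans _ (xc_le_xs _ mu1 muT _ P2 i).
  by apply: ereal_inf_lbound; exists (stat1 mu) => //; exact: stat1_policy.
exists xs; split; first by move=> i; split.
split.
  move=> y; split=> [yT i|/funext -> //].
  have [mu' [nu' [mu'1 nu'2 mu'T nu'T]]] := saddle y yT.
  (* Crossed pairs compare the two solutions: y is a subsolution and xs a supersolution for (mu,
     nu'), and conversely for (mu', nu). *)
  apply/eqP; rewrite eq_le; apply/andP; split.
    apply: (sub_le_super GM both_np mu1 nu'2); first exact: Tmn_ge_fixed.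
    exact: Tmn_le_fixed.
  apply: (sub_le_super GM both_np mu'1 nu2); first exact: Tmn_ge_fixed.
  exact: Tmn_le_fixed.
split; first by exists mu, nu; split => //; split => // i; split.
(* The pair found above is replaced by an arbitrary one; the bounds by [xs] were stated for every
   such policy. *)
move=> {muT nuT mu1 nu2} {}mu {}nu mu1 nu2 munuT.
have muT i := (munuT i).1; have nuT i := (munuT i).2.
have npmn : nonprolonging G mu nu.
  by apply: both_np => //; exists xs; [exact: Tmn_ge_fixed|exact: Tmn_le_fixed].
split.
  (* Since xs is a supersolution for (mu, nu'), the infinite cost given by (iii) cannot be +oo. *)
  split=> [|nu' nu'2 /(SSP3 _ _ mu1 nu'2)[i [] E]]; [by exists nu| |by exists i].
  have := xSD_lt_super hU hV GM mu1 nu'2 (Tmn_le_fixed _ _ _ nu'2 muT) i.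
  by rewrite E ltxx.
split.
  split=> [|mu' mu'1 /(SSP3 _ _ mu'1 nu2)[i [] E]]; [by exists mu|by exists i|].
  have := xSD_gt_sub hU hV GM mu'1 nu2 (Tmn_ge_fixed _ _ _ mu'1 nuT) i.
  by rewrite E ltxx.
split; first exact: npmn.
split.
  move=> p1 p2 P1 P2 i; split.
    apply: le_trans (xc_le_xs _ mu1 muT _ P2 i) _.
    exact: (xc_ge_xs _ nu2 nuT _ (stat1_policy mu1)).
  apply: le_trans _ (xc_ge_xs _ nu2 nuT _ P1 i).
  exact: (xc_le_xs _ mu1 muT _ (stat2_policy nu2)).
split; split; [exact: stat1_policy| |exact: stat2_policy|].
  by move=> i; rewrite upper sup_xs.
by move=> i; rewrite lower inf_xs.
Qed.
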